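(* For every partition $\lambda$, the modified $\imath$Hall-Littlewood function $H^{\imath}_\lambda$ specializes at $\theta=1$ to the deformed universal character of type C of Shimozono and Zabrocki: $$H^{\imath}_\lambda\big|_{\theta=1}=\mathbb B^{C}_\lambda .$$
   Context: Let $h_r$ denote the $r$-th complete homogeneous symmetric function in $x=(x_1,x_2,\ldots)$, with $h_0=1$, $h_a=0$ for $a<0$, and $h_\alpha=h_{\alpha_1}h_{\alpha_2}\cdots$ for integer sequences $\alpha$ with finitely many nonzero entries. Let $t,\theta$ be indeterminates. For $1\le i<j$ put $R_{ij}\alpha=(\ldots,\alpha_i+1,\ldots,\alpha_j-1,\ldots)$ and $L_{ij}\alpha=(\ldots,\alpha_i-1,\ldots,\alpha_j-1,\ldots)$, acting by $R_{ij}h_\alpha=h_{R_{ij}\alpha}$, $L_{ij}h_\alpha=h_{L_{ij}\alpha}$ (products of operators act on the index sequence first, then $h$ is evaluated). The modified $\imath$Hall-Littlewood function is $$H^{\imath}_\lambda=\prod_{1\le i<j}\frac{1-\theta L_{ij}}{1-\theta tL_{ij}}\,\frac{1-R_{ij}}{1-tR_{ij}}\;h_\lambda ,$$ a symmetric function with coefficients in $\mathbb Q(t)[\theta]$, where $\frac{1-u}{1-tu}$ is expanded as $1+(1-t^{-1})\sum_{s\ge1}t^su^s$. The deformed universal characters of type C, here denoted $\mathbb B^C_\lambda$ (in the original notation the superscript is the Young diagram with two boxes in one column), were introduced by Shimozono and Zabrocki (''Deformed universal characters for classical and affine algebras'', 2006) in plethystic notation via creation operators. Explicitly, for a symmetric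 function $P=P[X]$ over $\mathbb Q(t)$ and a variable $z$, let $P\big[X-(1-t)(z+z^{-1})\big]$ be the image of $P$ under the algebra map sending each power sum $p_k$ to $p_k-(1-t^k)(z^k+z^{-k})$, and let $\Omega[zX]=\sum_{r\ge0}h_rz^r$. For $r\in\mathbb Z$ the creation operator $\mathbb B^C_r$ is defined by letting $\mathbb B^C_r P$ be the coefficient of $z^r$ in $$P\big[X-(1-t)(z+z^{-1})\big]\;\Omega[zX].$$ For a partition $\lambda=(\lambda_1,\ldots,\lambda_\ell)$, one sets $\mathbb B^C_\lambda=\mathbb B^C_{\lambda_1}\mathbb B^C_{\lambda_2}\cdots\mathbb B^C_{\lambda_\ell}\cdot 1$. *)

(* Defs.v *)
From HB Require Import structures.
From mathcomp Require Import all_boot all_order all_algebra.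
From mathcomp Require Import finmap fraction.
From mathcomp Require Import boolp classical_sets functions cardinality fsbigop.
From mathcomp Require Import mpoly.

Set Implicit Arguments.
Unset Strict Implicit.
Unset Printing Implicit Defensive.

Import GRing.Theory.

Local Open Scope classical_set_scope.
Local Open Scope ring_scope.

(* A symmetric function f in x = (x_1, x_2, ...) is given by its restrictions
   f(x_1, ..., x_n), n >= 0, which determine it: the ring of symmetric functions
   is the graded inverse limit of the rings of symmetric polynomials in n
   variables, hence embeds in the product of these polynomial rings over n. *)
Definition symf (R : nzRingType) : Type := forall n : nat, {mpoly R[n]}.

Definition hsym (R : nzRingType) (r : int) : symf R := fun n =>
  match r with
  | Posz d => \sum_(m : 'X_{1..n < d.+1} | mdeg m == d) 'X_[m]
  | Negz _ => 0
  end.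

Definition psum (R : nzRingType) (k : nat) : symf R := fun n =>
  \sum_(i < n) 'X_i ^+ k.

(* Positions of index sequences are numbered from 0. *)
Definition idxseq : Type := nat -> int.

Definition Rop (ij : nat * nat) (alpha : idxseq) : idxseq := fun k =>
  alpha k + (k == ij.1)%:Z - (k == ij.2)%:Z.

Definition Lop (ij : nat * nat) (alpha : idxseq) : idxseq := fun k =>
  alpha k - (k == ij.1)%:Z - (k == ij.2)%:Z.

(* The product of the h_(alpha_k) over the k with h_(alpha_k) <> 1; it is the
   whole product since h_0 = 1 and alpha is finitely supported. *)
Definition hseq (R : nzRingType) (alpha : idxseq) : symf R := fun n =>
  \big[*%R/1]_(k \in [set: nat]) hsym R (alpha k) n.

Definition is_partition (la : seq nat) : bool :=
  sorted geq la && (0%N \notin la).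

Definition seq_idx (la : seq nat) : idxseq := fun k => (nth 0%N la k)%:Z.

(* The field Q(t). *)
Definition Qt : fieldType := {fraction {poly rat}}.
Definition tQ : Qt := tofrac 'X.

(* The coefficient of u^s in (1 - u) / (1 - t u). *)
Definition expcoef (s : nat) : Qt :=
  if s == 0%N then 1 else (1 - tQ^-1) * tQ ^+ s.

(* Finitely supported families of exponents, one for each pair (i, j). *)
Definition exponents : choiceType := {fsfun nat * nat -> nat with 0%N}.

Definition on_pairs (a : exponents) : Prop :=
  forall ij : nat * nat, ij \in finsupp a -> (ij.1 < ij.2)%N.

Definition opmonomial (op : nat * nat -> idxseq -> idxseq) (a : exponents) :
    idxseq -> idxseq :=
  \big[comp/id]_(ij <- finsupp a) iter (a ij) (op ij).

(* The coefficient, in Q(t)[theta] with theta = 'X, of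
   prod_(i < j) L_ij^(a_ij) R_ij^(b_ij) in the expansion of
   prod_(i < j) (1 - theta L_ij)/(1 - theta t L_ij) (1 - R_ij)/(1 - t R_ij). *)
Definition opcoef (a b : exponents) : {poly Qt} :=
  (\prod_(ij <- finsupp a) ((expcoef (a ij))%:P * 'X ^+ a ij)) *
  (\prod_(ij <- finsupp b) (expcoef (b ij))%:P).

(* The sum is over all pairs of exponent families on {(i, j) | i < j}; only
   finitely many of them yield a sequence without negative entries, hence a
   nonzero term. *)
Definition iHL (la : seq nat) : symf {poly Qt} := fun n =>
  \sum_(ab \in [set ab : exponents * exponents |
                 on_pairs ab.1 /\ on_pairs ab.2])
     opcoef ab.1 ab.2 *:
       hseq {poly Qt}
         ((opmonomial Lop ab.1 \o opmonomial Rop ab.2) (seq_idx la)) n.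

Definition at_theta1 (f : symf {poly Qt}) : symf Qt := fun n =>
  map_mpoly (horner_eval (1 : Qt)) (f n).

(* A polynomial in the first N power sums: the variable of index i < N stands
   for p_(i+1). *)
Definition pspoly : choiceType := {N : nat & {mpoly Qt[N]}}.

Definition ps_eval (F : pspoly) : symf Qt := fun n =>
  mmap (@mpolyC n Qt) (fun i : 'I_(tag F) => psum Qt i.+1 n) (tagged F).

(* The expression of f in the power sums (unique up to adding variables which
   do not occur); the default value is only used when f has none, that is, when
   f is not a symmetric function. *)
Definition ps_expr (f : symf Qt) : pspoly :=
  xget (existT (fun N => {mpoly Qt[N]}) 0%N 0) [set F | ps_eval F = f].

(* Laurent polynomials in z are represented by polynomials in two variables z
   (the outer one) and w (the inner one), where w stands for z^-1. *)
Definition pleth_var (k n : nat) : {poly {poly {mpoly Qt[n]}}} :=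
  (psum Qt k n)%:P%:P - ((1 - tQ ^+ k)%:MP%:P%:P) * ('X ^+ k + ('X ^+ k)%:P).

(* P[X - (1 - t)(z + z^-1)], restricted to x_1, ..., x_n. *)
Definition pleth (P : symf Qt) (n : nat) : {poly {poly {mpoly Qt[n]}}} :=
  mmap (fun c : Qt => c%:MP%:P%:P)
       (fun i : 'I_(tag (ps_expr P)) => pleth_var i.+1 n)
       (tagged (ps_expr P)).

(* The term z^a w^b of P[X - (1 - t)(z + z^-1)] is z^(a - b), so in the product
   with Omega[zX] it contributes to z^r through the term h_(r - a + b). *)
Definition BC_op (r : int) (P : symf Qt) : symf Qt := fun n =>
  \sum_(a < size (pleth P n)) \sum_(b < size (pleth P n)`_a)
     (pleth P n)`_a`_b * hsym Qt (r - a%:Z + b%:Z) n.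

Definition BC (la : seq nat) : symf Qt :=
  foldr (fun (r : nat) (P : symf Qt) => BC_op r%:Z P) (fun n => 1) la.

(* Main.v *)
(* With A(u) = (1 - u) / (1 - t u), the plethysm X -> X - (1 - t)(z + z^-1) maps
   the generating series H(u) of the h_r to H(u) A(z u) A(u / z).  Taking the
   coefficient of z^r against Omega[zX] turns z into L_{0i} and z^-1 into R_{0i}
   on the sequence (r, alpha), so the creation operator prepends an entry and
   multiplies by the factors of the raising operator formula for the pairs
   (0, i); the theorem follows by induction on the length of lambda.

   Newton's identities determine the h_r from the power sums in characteristic
   0, which yields the plethysm of h_r.  The plethysm does not depend on the
   chosen expression in the power sums, although their algebraic independence is
   not used: p_k - (1 - t^k)(z^k + w^k) is the k-th power sum of the alphabet
   x, t z, t w, to which z and w are adjoined with multiplicity -1.  For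
   multiplicities in nat an identity between polynomials in the power sums may be
   evaluated on this alphabet, and both sides are polynomial in the
   multiplicity. *)

From HB Require Import structures.
From mathcomp Require Import all_boot all_order all_algebra.
From mathcomp Require Import finmap fraction.
From mathcomp Require Import boolp classical_sets fsbigop.
From mathcomp Require Import mpoly zify ring.
Require Import Defs.

Set Implicit Arguments.
Unset Strict Implicit.
Unset Printing Implicit Defensive.

Import GRing.Theory.

Local Open Scope ring_scope.

(** * Plethystic substitution is well defined *)

Lemma rmorph_mmap (n : nat) (R : nzRingType) (S T : comNzRingType)
    (f : {rmorphism S -> T}) (c : R -> S) (h : 'I_n -> S) (p : {mpoly R[n]}) :
  f (mmap c h p) = mmap (f \o c) (f \o h) p.
Proof.
rewrite /mmap rmorph_sum; apply: eq_bigr => m _.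
rewrite rmorphM /mmap1 rmorph_prod; congr (_ * _).
by apply: eq_bigr => i _; rewrite rmorphXn.
Qed.

Lemma eq_mmap (n : nat) (R S : nzRingType) (c c' : R -> S) (h h' : 'I_n -> S)
    (p : {mpoly R[n]}) :
  c =1 c' -> h =1 h' -> mmap c h p = mmap c' h' p.
Proof.
move=> cE hE; rewrite /mmap; apply: eq_bigr => m _.
by rewrite cE (mmap1_eq _ hE).
Qed.

Lemma natr_inj_char0 (A : nzRingType) (char0 : forall m : nat, m.+1%:R != 0 :> A) :
  injective (fun m : nat => m%:R : A).
Proof.
have aux m k : (m + k.+1)%:R != m%:R :> A.
  by rewrite natrD -subr_eq0 addrAC subrr add0r.
move=> i j /= eij; case: (ltngtP i j) => // lij.
- by have := aux i (j - i.+1)%N; rewrite -addSnnS subnKC // eij eqxx.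
- by have := aux j (i - j.+1)%N; rewrite -addSnnS subnKC // eij eqxx.
Qed.

(** A nonzero difference would have as many distinct roots 0, 1, 2, ... as its size, one more than
    its degree allows. *)
Lemma poly_eq_nat (A : idomainType) (char0 : forall m : nat, m.+1%:R != 0 :> A)
    (p q : {poly A}) :
  (forall m : nat, p.[m%:R] = q.[m%:R]) -> p = q.
Proof.
move=> pq; apply/eqP; rewrite -subr_eq0; apply/eqP; apply: contraTeq isT => nz.
pose s := [seq m%:R : A | m <- iota 0 (size (p - q))].
suff: (size s < size (p - q)%R)%N by rewrite size_map size_iota ltnn.
apply: max_poly_roots => //.
  apply/allP => _ /mapP[m _ ->].
  by rewrite rootE hornerD hornerN pq subrr.
by rewrite map_inj_uniq ?iota_uniq //; exact: natr_inj_char0.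
Qed.

Lemma tofrac_char0 (m : nat) : m.+1%:R != 0 :> Qt.
Proof.
rewrite -(rmorph_nat (@tofrac {poly rat})) tofrac_eq0 -polyC_natr polyC_eq0.
by rewrite Num.Theory.pnatr_eq0.
Qed.

Lemma alg_char0 (A : nzRingType) (c : {rmorphism Qt -> A}) (m : nat) :
  m.+1%:R != 0 :> A.
Proof. by rewrite -(rmorph_nat c) fmorph_eq0 tofrac_char0. Qed.

(** Common form of [ps_eval] (with [p] the power sums in n variables) and of [pleth] (with [p] given
    by [pleth_var]). *)
Definition ps_subst (A : nzRingType) (c : Qt -> A) (p : nat -> A) (F : pspoly) : A :=
  mmap c (fun i : 'I_(tag F) => p i.+1) (tagged F).

Lemma eq_ps_subst (A : nzRingType) (c : Qt -> A) (p p' : nat -> A) (F : pspoly) :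
  p =1 p' -> ps_subst c p F = ps_subst c p' F.
Proof. by move=> e; apply: eq_mmap. Qed.

(** For a genuine finite alphabet [xs] the substitution factors through the restriction to [size xs]
    variables, followed by sending these variables to the letters. *)
Lemma ps_subst_powers (A : comNzRingType) (c : {rmorphism Qt -> A}) (F G : pspoly)
    (xs : seq A) :
  ps_eval F = ps_eval G ->
  ps_subst c (fun k => \sum_(x <- xs) x ^+ k) F
  = ps_subst c (fun k => \sum_(x <- xs) x ^+ k) G.
Proof.
move=> FG; pose f : {rmorphism {mpoly Qt[size xs]} -> A} :=
  mmap c (fun i : 'I_(size xs) => tnth (in_tuple xs) i).
have aux H : ps_subst c (fun k => \sum_(x <- xs) x ^+ k) H
    = f (ps_eval H (size xs)).
  rewrite /ps_eval rmorph_mmap; apply: eq_mmap => [a|i] /=.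
    by rewrite mmapC.
  rewrite /psum rmorph_sum [LHS]big_tnth; apply: eq_bigr => j _.
  by rewrite rmorphXn /= mmapX mmap1U.
by rewrite !aux FG.
Qed.

(* Both sides are polynomial in the multiplicity of [u], so equality for all
   multiplicities in [nat] implies equality for multiplicity [-1]. *)
Lemma ps_subst_remove (A : idomainType) (c : {rmorphism Qt -> A}) (F G : pspoly)
    (v : nat -> A) (u : A) :
  (forall m : nat, ps_subst c (fun k => v k + m%:R * u ^+ k) F
                 = ps_subst c (fun k => v k + m%:R * u ^+ k) G) ->
  ps_subst c (fun k => v k - u ^+ k) F = ps_subst c (fun k => v k - u ^+ k) G.
Proof.
move=> FG; pose q k : {poly A} := (v k)%:P + (u ^+ k)%:P * 'X.
pose D H := ps_subst (polyC \o c) q H.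
have DE H a : (D H).[a] = ps_subst c (fun k => v k + a * u ^+ k) H.
  rewrite -[LHS]/(horner_eval a (D H)) /D /ps_subst rmorph_mmap.
  apply: eq_mmap => [b|i] /=; rewrite /horner_eval.
    by rewrite hornerC.
  by rewrite /q !hornerE mulrC.
have DFG : D F = D G.
  apply: poly_eq_nat => [m|m]; first exact: alg_char0 c m.
  by rewrite !DE FG.
have aux H : ps_subst c (fun k => v k - u ^+ k) H = (D H).[-1].
  by rewrite DE; apply: eq_ps_subst => k; rewrite mulN1r.
by rewrite !aux DFG.
Qed.

(** The letters of multiplicity -1 are treated one at a time: first [w], with [z] kept at -1, then
    [z] for each natural multiplicity [b] of [w]. What remains is the finite alphabet of [ys] with
    [b] copies of [w] and [a] copies of [z]. *)
Lemma ps_subst_alphabet (A : idomainType) (c : {rmorphism Qt -> A}) (F G : pspoly)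
    (xs : seq A) (z w : A) (p : nat -> A) :
  (forall k, p k = \sum_(x <- xs) x ^+ k - (1 - c tQ ^+ k) * (z ^+ k + w ^+ k)) ->
  ps_eval F = ps_eval G -> ps_subst c p F = ps_subst c p G.
Proof.
move=> pE FG; pose ys := c tQ * z :: c tQ * w :: xs.
pose v k : A := \sum_(x <- ys) x ^+ k.
have vE k : p k = v k - z ^+ k - w ^+ k.
  by rewrite pE /v !big_cons !exprMn; ring.
rewrite !(eq_ps_subst _ _ vE); apply: ps_subst_remove => b.
have v1E k : v k - z ^+ k + b%:R * w ^+ k = v k + b%:R * w ^+ k - z ^+ k.
  by rewrite addrAC.
rewrite !(eq_ps_subst _ _ v1E).
apply: (@ps_subst_remove _ c F G (fun k => v k + b%:R * w ^+ k)) => a.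
have v2E k : v k + b%:R * w ^+ k + a%:R * z ^+ k
    = \sum_(x <- ys ++ nseq b w ++ nseq a z) x ^+ k.
  by rewrite !big_cat /= !big_nseq !iter_addr_0 !mulr_natl addrA.
rewrite !(eq_ps_subst _ _ v2E); exact: ps_subst_powers.
Qed.

Definition polyC2 (R : nzRingType) (a : R) : {poly {poly R}} := a%:P%:P.

HB.instance Definition _ (R : nzRingType) :=
  GRing.RMorphism.copy (@polyC2 R) (polyC \o polyC).

Lemma ps_subst_polyC2 (R : idomainType) (c : {rmorphism Qt -> R}) (F G : pspoly)
    (xs : seq R) (p : nat -> {poly {poly R}}) :
  (forall k, p k = polyC2 (\sum_(x <- xs) x ^+ k)
    - polyC2 (1 - c tQ ^+ k) * ('X ^+ k + 'X%:P ^+ k)) ->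
  ps_eval F = ps_eval G ->
  ps_subst (@polyC2 R \o c) p F = ps_subst (@polyC2 R \o c) p G.
Proof.
move=> pE.
apply: (@ps_subst_alphabet {poly {poly R}} (@polyC2 R \o c) F G
          [seq polyC2 x | x <- xs] 'X 'X%:P) => k.
rewrite pE rmorphB rmorph1 rmorphXn big_map rmorph_sum; congr (_ - _).
by apply: eq_bigr => x _; rewrite rmorphXn.
Qed.

Lemma pleth_varE (n k : nat) :
  pleth_var k n = polyC2 (psum Qt k n)
    - polyC2 (1 - tQ%:MP ^+ k) * ('X ^+ k + 'X%:P ^+ k).
Proof.
rewrite -[LHS]/(polyC2 (psum Qt k n)
  - polyC2 ((1 - tQ ^+ k)%:MP) * ('X ^+ k + ('X ^+ k)%:P)).
rewrite (rmorphXn polyC).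
have -> // : (1 - tQ ^+ k)%:MP = 1 - tQ%:MP ^+ k :> {mpoly Qt[n]}.
by rewrite mpolyCB mpolyC1 (rmorphXn (@mpolyC n Qt)).
Qed.

(** This lets the representative chosen by [ps_expr] be replaced by any other expression of the same
    symmetric function. *)
Lemma ps_subst_pleth_var (F G : pspoly) (n : nat) :
  ps_eval F = ps_eval G ->
  ps_subst (@polyC2 _ \o @mpolyC n Qt) (pleth_var ^~ n) F
  = ps_subst (@polyC2 _ \o @mpolyC n Qt) (pleth_var ^~ n) G.
Proof.
apply: (@ps_subst_polyC2 {mpoly Qt[n]} (@mpolyC n Qt) F G [seq 'X_i | i : 'I_n]).
by move=> k; rewrite big_map big_enum pleth_varE.
Qed.

(** * Newton's identities *)

(** The recurrence stops at degree [N] so that it also makes sense in a polynomial ring where only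
    the first [N] power sums are available as variables. *)
Definition newton (A : nzRingType) (N : nat) (q h : nat -> A) : Prop :=
  h 0%N = 1 /\
  forall r, (r < N)%N -> r.+1%:R * h r.+1 = \sum_(k < r.+1) q k.+1 * h (r - k)%N.

Definition conv (A : nzRingType) (f g : nat -> A) (r : nat) : A :=
  \sum_(i < r.+1) f i * g (r - i)%N.

Lemma newton_uniq (A : idomainType) (char0 : forall m : nat, m.+1%:R != 0 :> A)
    (N : nat) (q q' h h' : nat -> A) :
  newton N q h -> newton N q' h' ->
  (forall k, (0 < k <= N)%N -> q k = q' k) ->
  forall r, (r <= N)%N -> h r = h' r.
Proof.
move=> [h0 hS] [h0' hS'] qq; elim/ltn_ind=> -[|r] IH rN; first by rewrite h0 h0'.
apply: (mulfI (char0 r)); rewrite hS // hS' //; apply: eq_bigr => k _.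
by rewrite qq ?IH //; have := ltn_ord k; lia.
Qed.

Lemma newton_rmorph (A B : nzRingType) (f : {rmorphism A -> B}) (N : nat)
    (q h : nat -> A) :
  newton N q h -> newton N (f \o q) (f \o h).
Proof.
move=> [h0 hS]; split=> [|r rN] /=; first by rewrite h0 rmorph1.
rewrite -(rmorph_nat f) -rmorphM hS // rmorph_sum.
by apply: eq_bigr => k _; rewrite rmorphM.
Qed.

Lemma conv_coef (A : nzRingType) (f g : nat -> A) (N r : nat) :
  (r < N)%N -> conv f g r = ((\poly_(i < N) f i) * (\poly_(i < N) g i))`_r.
Proof.
move=> rN; rewrite coefM; apply: eq_bigr => i _.
by rewrite !coef_poly !ifT //; have := ltn_ord i; lia.
Qed.

(** The Leibniz rule for the derivation u d/du on generating series. *)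
Lemma conv_nat_sum (A : comNzRingType) (f g : nat -> A) (r : nat) :
  r%:R * conv f g r
  = conv (fun i => i%:R * f i) g r + conv f (fun i => i%:R * g i) r.
Proof.
rewrite /conv mulr_sumr -big_split; apply: eq_bigr => i _ /=.
rewrite -{1}(subnK (_ : i <= r)%N) ?natrD -1?ltnS ?ltn_ord //.
by rewrite addrC; ring.
Qed.

(** Degree [r] only sees the truncations to polynomials of size at most [r.+1], whose product is
    associative. *)
Lemma convA (A : nzRingType) (f g h : nat -> A) (r : nat) :
  conv (conv f g) h r = conv f (conv g h) r.
Proof.
pose P (f : nat -> A) := \poly_(i < r.+1) f i.
have -> : conv (conv f g) h r = (P f * P g * P h)`_r.
  rewrite coefM; apply: eq_bigr => i _.
  rewrite -(@conv_coef _ f g r.+1) // coef_poly ifT //.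
  by rewrite ltnS leq_subr.
rewrite -mulrA coefM; apply: eq_bigr => i _.
by rewrite -(@conv_coef _ g h r.+1) ?ltnS ?leq_subr // coef_poly ltn_ord.
Qed.

Lemma convC (A : comNzRingType) (f g : nat -> A) (r : nat) :
  conv f g r = conv g f r.
Proof.
rewrite /conv (reindex_inj rev_ord_inj) /=; apply: eq_bigr => i _.
by rewrite subSS subKn -1?ltnS ?ltn_ord // mulrC.
Qed.

Lemma eq_conv (A : nzRingType) (f f' g g' : nat -> A) (r : nat) :
  (forall i, (i <= r)%N -> f i = f' i) -> (forall i, (i <= r)%N -> g i = g' i) ->
  conv f g r = conv f' g' r.
Proof.
move=> ef eg; apply: eq_bigr => i _; rewrite ef ?eg ?leq_subr //.
by rewrite -ltnS ltn_ord.
Qed.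

(** In generating series this is u H'(u) = Q(u) H(u), where Q has constant term 0 whatever the value
    of [q 0]. *)
Lemma newtonE (A : nzRingType) (N : nat) (q h : nat -> A) :
  newton N q h <->
  h 0%N = 1 /\ forall r, (r <= N)%N ->
    r%:R * h r = conv (fun k => if k is 0%N then 0 else q k) h r.
Proof.
split=> -[h0 hS]; split=> // r.
  case: r => [|r] rN; first by rewrite /conv big_ord1 /= mulr0n !mul0r.
  by rewrite hS // /conv [RHS]big_ord_recl /= mul0r add0r.
by move=> rN; rewrite hS // /conv [LHS]big_ord_recl /= mul0r add0r.
Qed.

(** Logarithmic derivatives add when generating series are multiplied. *)
Lemma newton_conv (A : comNzRingType) (N : nat) (q q' h h' : nat -> A) :
  newton N q h -> newton N q' h' ->
  newton N (fun k => q k + q' k) (conv h h').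
Proof.
move=> /newtonE[h0 hE] /newtonE[h0' hE']; apply/newtonE.
split=> [|r rN]; first by rewrite /conv big_ord1 h0 h0' mulr1.
set p := fun k => if k is 0%N then 0 else q k in hE *.
set p' := fun k => if k is 0%N then 0 else q' k in hE' *.
rewrite conv_nat_sum.
rewrite (@eq_conv _ _ (conv p h) h' h') //; last first.
  by move=> i ir; rewrite hE // (leq_trans ir).
rewrite (@eq_conv _ h h _ (conv p' h')) //; last first.
  by move=> i ir; rewrite hE' // (leq_trans ir).
rewrite convA -[X in _ + X]convA.
rewrite (@eq_conv _ (conv h p') (conv p' h) h' h') //; last first.
  by move=> i _; rewrite convC.
rewrite convA /conv -big_split; apply: eq_bigr => i _ /=.
by rewrite -mulrDl; congr (_ * _); rewrite /p /p'; case: (i : nat) => //=; rewrite addr0.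
Qed.

Lemma newton_geom (A : comNzRingType) (N : nat) (x : A) :
  newton N (fun k => x ^+ k) (fun r => x ^+ r).
Proof.
split=> // r _; rewrite (eq_bigr (fun=> x ^+ r.+1)).
  by rewrite sumr_const card_ord mulr_natl.
by move=> k _; rewrite -exprD addSn subnKC // -ltnS.
Qed.

(** A letter [x] of multiplicity -1 has generating series 1 - x u. *)
Lemma newton_opp (A : comNzRingType) (N : nat) (x : A) :
  newton N (fun k => - x ^+ k)
    (fun r => if r is r'.+1 then if r' is 0%N then - x else 0 else 1).
Proof.
split=> // -[|r] _; first by rewrite big_ord1 mul1r mulr1 expr1.
(* Only the last two terms of the sum survive, and they cancel. *)
rewrite mulr0 !big_ord_recr /= subnn subSnn big1; last first.
  move=> k _; have -> : (r.+1 - k = (r - k.+1).+2)%N by have := ltn_ord k; lia.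
  by rewrite mulr0.
by rewrite add0r mulr1 mulrNN -exprSr subrr.
Qed.

Lemma newton_exists (F : fieldType) (A : comAlgType F)
    (char0 : forall m : nat, m.+1%:R != 0 :> F) (N : nat) (q : nat -> A) :
  exists h, newton N q h.
Proof.
(* Each new value depends on all earlier ones, so the solution is read off lists that grow by one
   entry, starting from [h 0 = 1]. *)
pose ext (s : seq A) :=
  rcons s ((size s)%:R^-1 *: \sum_(k < size s) q k.+1 * s`_(size s - k.+1)%N).
pose s n := iter n ext [:: 1].
have sz n : size (s n) = n.+1 by elim: n => //= n IH; rewrite size_rcons IH.
have sE r n : (r <= n)%N -> (s n)`_r = (s r)`_r.
  elim: n => [|n IH]; first by rewrite leqn0 => /eqP ->.
  rewrite leq_eqVlt => /predU1P[-> //|rn].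
  by rewrite /= nth_rcons sz rn IH.
exists (fun r => (s r)`_r); split=> // r _ /=.
rewrite nth_rcons sz ltnn eqxx mulr_natl -scaler_nat scalerA.
rewrite mulfV // scale1r; apply: eq_bigr => k _.
by rewrite subSS sE // leq_subr.
Qed.

Lemma mcoeff_hsym (R : nzRingType) (n r : nat) (m : 'X_{1..n}) :
  (hsym R r n)@_m = (mdeg m == r)%:R.
Proof.
rewrite /hsym big_mkcond /=.
rewrite (eq_bigr (fun m' : 'X_{1..n < r.+1} => (mdeg m' == r)%:R *: 'X_[m'])).
  have [mr|rm] := ltnP (mdeg m) r.+1.
    by rewrite (mcoeff_mpoly (fun m' => (mdeg m' == r)%:R)).
  rewrite raddf_sum big1 ?gtn_eqF //= => m' _.
  rewrite mcoeffZ mcoeffX; case: (bmnm m' =P m) => [e|]; last by rewrite mulr0.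
  by rewrite e gtn_eqF ?mul0r.
by move=> m' _; case: eqP; rewrite ?scale1r ?scale0r.
Qed.

Lemma mnm1Mn_le (n k : nat) (i : 'I_n) (m : 'X_{1..n}) :
  (k <= m i)%N -> (U_(i) *+ k <= m)%MM.
Proof.
move=> km; apply/mnm_lepP => j; rewrite mulmnE mnm1E.
by case: eqP => [<-|_]; rewrite ?mul1n ?mul0n.
Qed.

Lemma mcoeff_XnM (R : nzRingType) (n k : nat) (i : 'I_n) (p : {mpoly R[n]})
    (m : 'X_{1..n}) :
  ('X_i ^+ k * p)@_m = if (k <= m i)%N then p@_(m - U_(i) *+ k)%MM else 0.
Proof.
rewrite mpolyXn -(commr_mpolyX _ p); case: ifP => [km|/negP km].
  by rewrite -[in LHS](submK (mnm1Mn_le km)) addmC mcoeffMX.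
rewrite mcoeffMr big1 // => -[k1 k2] /= /eqP mE; rewrite mcoeffX.
case: eqP => [e|_]; last by rewrite mulr0.
case: km; rewrite mE -e mnmDE mulmnE mnm1E eqxx mul1n; lia.
Qed.

(** Compare the coefficients of a monomial [m] of degree [r.+1]: the powers of x_i that divide it,
    of exponents 1 to [m i], contribute [m i] in total, and the [m i] add up to the degree. *)
Lemma newton_hsym (R : nzRingType) (n N : nat) :
  newton N (fun k => psum R k n) (fun r => hsym R r n).
Proof.
split=> [|r _]; apply/mpolyP => m.
  by rewrite mcoeff_hsym mcoeff1 mdeg_eq0.
rewrite mulr_natl mcoeffMn mcoeff_hsym raddf_sum /=.
under eq_bigr do rewrite /psum mulr_suml raddf_sum.
rewrite exchange_big /=.
transitivity (\sum_(i < n) ((mdeg m == r.+1)%:R *+ m i : R)).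
  rewrite sumrMnr -mdegE; case: eqP => [-> //|_].
  by rewrite !mul0rn.
apply: eq_bigr => i _; have mi : (m i <= mdeg m)%N.
  by rewrite mdegE (bigD1 i) //= leq_addr.
rewrite (eq_bigr (fun k : 'I_r.+1 =>
  if (k < m i)%N then (mdeg m == r.+1)%:R else 0 : R)); last first.
  move=> k _; rewrite mcoeff_XnM mcoeff_hsym; case: ifP => // ki.
  congr (_%:R); congr nat_of_bool.
  have -> : mdeg (m - U_(i) *+ k.+1) = (mdeg m - k.+1)%N.
    by rewrite -[in RHS](submK (mnm1Mn_le ki)) mdegD mdegMn mdeg1 mul1n addnK.
  by have := ltn_ord k; lia.
case: eqP => [e|_]; last by rewrite mul0rn big1 // => k _; case: ifP.
rewrite -big_mkcond /= -(big_ord_widen r.+1 (fun=> 1)) -?e //.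
by rewrite sumr_const card_ord.
Qed.

(** * The plethysm of the complete homogeneous functions *)

Lemma tQ_neq0 : tQ != 0.
Proof. by rewrite tofrac_eq0 polyX_eq0. Qed.

Lemma expcoefS (r : nat) : expcoef r.+1 = tQ ^+ r.+1 - tQ ^+ r.
Proof.
by rewrite /expcoef /= mulrBl mul1r exprS mulKf ?tQ_neq0.
Qed.

(** The series A(z u) = (1 - z u) / (1 - t z u) belongs to the letter t z together with z of
    multiplicity -1. *)
Lemma newton_expcoef (A : comNzRingType) (c : {rmorphism Qt -> A}) (N : nat) (z : A) :
  newton N (fun k => - z ^+ k + (c tQ * z) ^+ k) (fun r => c (expcoef r) * z ^+ r).
Proof.
have [h0 hS] := newton_conv (newton_opp N z) (newton_geom N (c tQ * z)).
set h := conv _ _ in h0 hS.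
suff hE r : h r = c (expcoef r) * z ^+ r.
  split=> [|r rN]; first by rewrite -hE.
  by rewrite -hE hS //; apply: eq_bigr => k _; rewrite hE.
case: r => [|r]; first by rewrite h0 /expcoef /= rmorph1 mulr1.
(* The factor 1 - z u has degree one, so the product has at most two terms in each degree. *)
rewrite /h /conv big_ord_recl big_ord_recl big1 => [|i _]; last by rewrite /= mul0r.
rewrite expcoefS rmorphB !rmorphXn /= subSS !subn0 addr0 mul1r mulrBl !exprMn.
by rewrite mulNr mulrCA -exprS.
Qed.

Lemma big_ord_vanish (V : nmodType) (m n : nat) (F : nat -> V) :
  (m <= n)%N -> (forall i, (m <= i)%N -> F i = 0) ->
  \sum_(i < n) F i = \sum_(i < m) F i.
Proof.
move=> mn F0; rewrite (big_ord_widen n F mn) [RHS]big_mkcond /=.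
by apply: eq_bigr => i _; case: ltnP => // /F0.
Qed.

(** The coefficient of u^a in H(u) A(z u) A(w u), with ['X] for z, ['X%:P] for w, and both
    expansions of A cut off at exponent [M]. The index is an integer because the operators can make
    entries negative. *)
Definition hpleth (R : comNzRingType) (c : Qt -> R) (M : nat) (h : int -> R) (a : int) :
    {poly {poly R}} :=
  \sum_(s < M) polyC2 (c (expcoef s)) * ('X ^+ s *
    \sum_(s' < M) polyC2 (c (expcoef s')) * ('X%:P ^+ s' *
      polyC2 (h (a - s%:Z - s'%:Z)))).

Lemma hpleth_neg (R : comNzRingType) (c : Qt -> R) (M : nat) (h : int -> R) (a : int) :
  (forall a : int, a < 0 -> h a = 0) -> a < 0 -> hpleth c M h a = 0.
Proof.
move=> h0 a0; rewrite /hpleth big1 // => s _; rewrite big1 ?mulr0 // => s' _.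
by rewrite h0 ?rmorph0 ?mulr0 //; lia.
Qed.

Lemma hpleth_conv (R : comNzRingType) (c : Qt -> R) (M : nat) (h : int -> R) (r : nat) :
  (forall a : int, a < 0 -> h a = 0) -> (r < M)%N ->
  hpleth c M h r = conv (fun s => polyC2 (c (expcoef s)) * 'X ^+ s)
    (conv (fun s => polyC2 (c (expcoef s)) * 'X%:P ^+ s)
       (fun r => polyC2 (h r%:Z))) r.
Proof.
move=> h0 rM; rewrite /hpleth.
rewrite (@big_ord_vanish _ r.+1 M (fun s => polyC2 (c (expcoef s)) * ('X ^+ s *
    \sum_(s' < M) polyC2 (c (expcoef s')) * ('X%:P ^+ s' *
      polyC2 (h (r%:Z - s%:Z - s'%:Z)))))) //; last first.
  move=> s rs; rewrite big1 ?mulr0 // => s' _.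
  by rewrite h0 ?rmorph0 ?mulr0 //; lia.
apply: eq_bigr => s _; rewrite mulrA; congr (_ * _).
have sr : (s <= r)%N by rewrite -ltnS.
rewrite (@big_ord_vanish _ (r - s).+1 M (fun s' => polyC2 (c (expcoef s')) *
    ('X%:P ^+ s' * polyC2 (h (r%:Z - s%:Z - s'%:Z))))) //; last 2 first.
- by apply: leq_trans rM; rewrite ltnS leq_subr.
- by move=> s' rs; rewrite h0 ?rmorph0 ?mulr0 //; lia.
apply: eq_bigr => s' _; rewrite mulrA; congr (_ * polyC2 (h _)).
by have := ltn_ord s'; lia.
Qed.

(** The factors A(z u), A(w u), H(u) contribute the power sums (t z)^k - z^k, (t w)^k - w^k and p_k,
    which add up to the plethystic substitution. *)
Lemma hpleth_newton (R : comNzRingType) (c : {rmorphism Qt -> R}) (M N : nat)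
    (p : nat -> R) (h : int -> R) :
  (forall a : int, a < 0 -> h a = 0) -> (N < M)%N ->
  newton N p (fun r => h r%:Z) ->
  newton N
    (fun k => polyC2 (p k) - polyC2 (1 - c tQ ^+ k) * ('X ^+ k + 'X%:P ^+ k))
    (fun r => hpleth c M h r%:Z).
Proof.
move=> h0 NM hp; set C : {rmorphism Qt -> {poly {poly R}}} := @polyC2 R \o c.
have [H0 HS] := newton_conv (newton_expcoef C N 'X)
  (newton_conv (newton_expcoef C N 'X%:P) (newton_rmorph (@polyC2 R) hp)).
split=> [|r rN]; first by rewrite hpleth_conv ?(leq_ltn_trans _ NM).
rewrite hpleth_conv ?(leq_trans _ NM) // HS //; apply: eq_bigr => k _.
rewrite hpleth_conv ?(leq_trans _ NM) //; last by rewrite ltnS (leq_trans (leq_subr _ _)) // ltnW.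
congr (_ * _).
have cE : polyC2 (1 - c tQ ^+ k.+1) = 1 - C tQ ^+ k.+1.
  rewrite -(rmorphXn c) -(rmorph1 c) -(rmorphB c).
  by rewrite -[LHS]/(C (1 - tQ ^+ k.+1)) (rmorphB C) (rmorph1 C) (rmorphXn C).
have arith (B : comNzRingType) (a z w u : B) :
  - z + a * z + (- w + a * w + u) = u - (1 - a) * (z + w) by ring.
by rewrite cE [(C tQ * _) ^+ _]exprMn [(C tQ * 'X%:P) ^+ _]exprMn; apply: arith.
Qed.

Lemma hpleth_uniq (R : idomainType) (c : {rmorphism Qt -> R}) (M N : nat)
    (p : nat -> R) (h : int -> R) (q g : nat -> {poly {poly R}}) :
  (forall a : int, a < 0 -> h a = 0) -> (N < M)%N ->
  newton N p (fun r => h r%:Z) -> newton N q g ->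
  (forall k, (0 < k <= N)%N ->
    q k = polyC2 (p k) - polyC2 (1 - c tQ ^+ k) * ('X ^+ k + 'X%:P ^+ k)) ->
  g N = hpleth c M h N.
Proof.
move=> h0 NM hp hq qE; apply: (newton_uniq _ hq (hpleth_newton c h0 NM hp) qE) => //.
exact: (alg_char0 (@polyC2 R \o c)).
Qed.

(** * Symmetric functions paired with their plethysms *)

(** Adding variables brings two expressions into one polynomial ring. The same [G] serves every
    target ring, hence both [ps_eval] and the plethysm. *)
Lemma ps_subst_widen (F : pspoly) (N : nat) : (tag F <= N)%N ->
  exists G : {mpoly Qt[N]},
    forall (A : comNzRingType) (c : {rmorphism Qt -> A}) (p : nat -> A),
      ps_subst c p (existT _ N G) = ps_subst c p F.
Proof.
case: F => n F /= nN.
exists (mmap (@mpolyC N Qt) (fun i => 'X_(widen_ord nN i)) F) => A c p.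
rewrite /ps_subst /= rmorph_mmap; apply: eq_mmap => [a|i] /=.
  by rewrite mmapC.
by rewrite mmapX mmap1U.
Qed.

Definition pleth_coef (n : nat) : {rmorphism Qt -> {poly {poly {mpoly Qt[n]}}}} :=
  @polyC2 _ \o @mpolyC n Qt.

(** A single expression in the power sums must yield both [P] and [Q] in every number of variables.
    Unlike [pleth], this involves no choice and is built up along ring operations. *)
Definition pleth_rel (P : symf Qt) (Q : forall n, {poly {poly {mpoly Qt[n]}}}) : Prop :=
  exists F : pspoly, forall n,
    P n = ps_eval F n /\ Q n = ps_subst (pleth_coef n) (pleth_var ^~ n) F.

Lemma pleth_relE (P : symf Qt) (Q : forall n, {poly {poly {mpoly Qt[n]}}}) (n : nat) :
  pleth_rel P Q -> pleth P n = Q n.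
Proof.
case=> F FE; have [_ ->] := FE n.
have FP : ps_eval F = P.
  by apply: functional_extensionality_dep => m; have [-> _] := FE m.
apply: ps_subst_pleth_var; rewrite FP.
exact: (@xgetI pspoly _ [set F | ps_eval F = P]%classic F FP).
Qed.

Lemma eq_pleth_rel (P P' : symf Qt) (Q Q' : forall n, {poly {poly {mpoly Qt[n]}}}) :
  (forall n, P n = P' n) -> (forall n, Q n = Q' n) ->
  pleth_rel P Q -> pleth_rel P' Q'.
Proof. by move=> eP eQ [F FE]; exists F => n; rewrite -eP -eQ. Qed.

(** An operation natural in the ring can be performed on the expressions themselves; this covers sum
    and product at once. *)
Lemma pleth_rel_poly2 (P P' : symf Qt) (Q Q' : forall n, {poly {poly {mpoly Qt[n]}}}) 
    (op : forall A : comNzRingType, A -> A -> A) :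
  (forall (A B : comNzRingType) (f : {rmorphism A -> B}) x y,
     f (op A x y) = op B (f x) (f y)) ->
  pleth_rel P Q -> pleth_rel P' Q' ->
  pleth_rel (fun n => op _ (P n) (P' n)) (fun n => op _ (Q n) (Q' n)).
Proof.
move=> opE [F FE] [F' FE']; pose N := maxn (tag F) (tag F').
have [G GE] := ps_subst_widen (leq_maxl (tag F) (tag F') : (_ <= N)%N).
have [G' GE'] := ps_subst_widen (leq_maxr (tag F) (tag F') : (_ <= N)%N).
exists (existT _ N (op _ G G')) => n.
have [-> ->] := FE n; have [-> ->] := FE' n; split.
  rewrite -[ps_eval F n]/(ps_subst (@mpolyC n Qt) (psum Qt ^~ n) F).
  rewrite -[ps_eval F' n]/(ps_subst (@mpolyC n Qt) (psum Qt ^~ n) F').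
  by rewrite -GE -GE' -opE.
by rewrite -GE -GE' -opE.
Qed.

Lemma pleth_rel_const (a : Qt) :
  pleth_rel (fun n => a%:MP) (fun n => pleth_coef n a).
Proof.
by exists (existT _ 0%N a%:MP) => n; rewrite /ps_eval /ps_subst /= !mmapC.
Qed.

Lemma pleth_relD P P' Q Q' : pleth_rel P Q -> pleth_rel P' Q' ->
  pleth_rel (fun n => P n + P' n) (fun n => Q n + Q' n).
Proof.
apply: (@pleth_rel_poly2 _ _ _ _ (fun A x y => x + y)) => A B f x y.
exact: rmorphD.
Qed.

Lemma pleth_relM P P' Q Q' : pleth_rel P Q -> pleth_rel P' Q' ->
  pleth_rel (fun n => P n * P' n) (fun n => Q n * Q' n).
Proof.
apply: (@pleth_rel_poly2 _ _ _ _ (fun A x y => x * y)) => A B f x y.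
exact: rmorphM.
Qed.

(** Newton's recurrence is solved once, over variables standing for the power sums. Its solution
    maps to [hsym] under evaluation and to [hpleth] under plethysm, by uniqueness in each target
    ring. *)
Lemma pleth_rel_hsym (M d : nat) : (d < M)%N ->
  pleth_rel (hsym Qt d)
    (fun n => hpleth (@mpolyC n Qt) M (hsym Qt ^~ n) d).
Proof.
move=> dM.
(* The variable of index [k.-1] stands for p_k; up to degree [d] the recurrence reads [q] only at 1
   <= k <= d. *)
pose q k : {mpoly Qt[d]} := if insub k.-1 is Some i then 'X_i else 0.
have qE (k : 'I_d) : q k.+1 = 'X_k by rewrite /q /= valK.
have [h hq] := @newton_exists Qt {mpoly Qt[d]} tofrac_char0 d q.
exists (existT _ d (h d)) => n; split.
  pose f : {rmorphism {mpoly Qt[d]} -> {mpoly Qt[n]}} :=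
    mmap (@mpolyC n Qt) (fun i : 'I_d => psum Qt i.+1 n).
  apply: (@newton_uniq {mpoly Qt[n]} (alg_char0 (@mpolyC n Qt)) d _ _
    _ (f \o h) (newton_hsym Qt n d) (newton_rmorph f hq)) => // k /andP[k0 kd].
  case: k k0 kd => // k _ kd.
  by rewrite /= (qE (Ordinal kd)) /= mmapX mmap1U.
pose f : {rmorphism {mpoly Qt[d]} -> {poly {poly {mpoly Qt[n]}}}} :=
  mmap (pleth_coef n) (fun i : 'I_d => pleth_var i.+1 n).
apply/esym/(@hpleth_uniq {mpoly Qt[n]} (@mpolyC n Qt) M d _ (hsym Qt ^~ n) _
  (f \o h) _ dM (newton_hsym Qt n d) (newton_rmorph f hq)); first by case.
case=> // k kd; rewrite -pleth_varE /= (qE (Ordinal kd)).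
by rewrite mmapX mmap1U.
Qed.

(** * Extraction of the coefficient of z^r *)

(** The sum in [BC_op], with the polynomial and the sequence of the h_r made arbitrary. *)
Definition extract (R : nzRingType) (h : int -> R) (r : int) (Q : {poly {poly R}}) : R :=
  \sum_(a < size Q) \sum_(b < size Q`_a) Q`_a`_b * h (r - a%:Z + b%:Z).

Definition bidegree_lt (R : nzRingType) (K : nat) (Q : {poly {poly R}}) : Prop :=
  forall a b, Q`_a`_b != 0 -> (a < K)%N && (b < K)%N.

Lemma bidegree_ltW (R : nzRingType) (K K' : nat) (Q : {poly {poly R}}) :
  (K <= K')%N -> bidegree_lt K Q -> bidegree_lt K' Q.
Proof. by move=> KK' QK a b /QK/andP[aK bK]; rewrite !(leq_trans _ KK'). Qed.

(** The ranges in [extract] depend on the sizes of [Q] and its coefficients; a common square range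
    makes different polynomials comparable, as additivity requires. *)
Lemma extractE (R : nzRingType) (h : int -> R) (r : int) (K : nat) (Q : {poly {poly R}}) :
  bidegree_lt K Q ->
  extract h r Q = \sum_(a < K) \sum_(b < K) Q`_a`_b * h (r - a%:Z + b%:Z).
Proof.
move=> QK; pose f a b := Q`_a`_b * h (r - a%:Z + b%:Z).
have f0 a b : ~~ ((a < K)%N && (b < K)%N) -> f a b = 0.
  by move=> nK; rewrite /f (contraNeq (@QK a b) nK) mul0r.
pose s := size Q.
have inner (a m : nat) : (size (Q`_a)%R <= m)%N ->
    \sum_(b < size Q`_a) f a b = \sum_(b < m) f a b.
  move=> sm; rewrite (@big_ord_vanish _ (size Q`_a) m (f a)) // => b sb.
  by rewrite /f nth_default ?mul0r.
pose m := maxn K (\max_(a < s) size (Q`_a)%R).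
have -> : extract h r Q = \sum_(a < s) \sum_(b < m) f a b.
  apply: eq_bigr => a _; apply: inner; rewrite leq_max; apply/orP; right.
  exact: (leq_bigmax (F := fun a : 'I_s => size Q`_a) a).
have -> : \sum_(a < s) \sum_(b < m) f a b = \sum_(a < s) \sum_(b < K) f a b.
  apply: eq_bigr => a _; apply: (@big_ord_vanish _ _ _ (f a)).
    exact: leq_maxl.
  by move=> b Kb; rewrite f0 // [(b < K)%N]ltnNge Kb andbF.
pose g a := \sum_(b < K) f a b.
rewrite -[LHS]/(\sum_(a < s) g a) -[RHS]/(\sum_(a < K) g a).
rewrite -(@big_ord_vanish _ s (maxn s K) g) ?leq_maxl //; last first.
  by move=> a sa; rewrite /g big1 // => b _; rewrite /f (nth_default 0 sa) coef0 mul0r.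
apply: big_ord_vanish; rewrite ?leq_maxr // => a Ka.
by rewrite /g big1 // => b _; rewrite f0 // [(a < K)%N]ltnNge Ka.
Qed.

Lemma bidegree_lt_exists (R : nzRingType) (Q : {poly {poly R}}) :
  exists K, bidegree_lt K Q.
Proof.
exists (maxn (size Q) (\max_(a < size Q) size (Q`_a)%R)) => a b nz.
have aQ : (a < size Q)%N.
  by rewrite ltnNge; apply: contra nz => Qa; rewrite (nth_default 0 Qa) coef0.
have bQ : (b < size (Q`_a)%R)%N.
  by rewrite ltnNge; apply: contra nz => Qa; rewrite nth_default.
rewrite !leq_max aQ /=; apply/orP; right; apply: leq_trans bQ _.
exact: (leq_bigmax (F := fun a : 'I_(size Q) => size Q`_a) (Ordinal aQ)).
Qed.

Lemma extractD (R : nzRingType) (h : int -> R) (r : int) :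
  {morph extract h r : P Q / P + Q}.
Proof.
move=> P Q; have [K PK] := bidegree_lt_exists P; have [K' QK] := bidegree_lt_exists Q.
have {}PK := bidegree_ltW (leq_maxl K K') PK.
have {}QK := bidegree_ltW (leq_maxr K K') QK.
rewrite !(@extractE _ h r (maxn K K')) //; last first.
  move=> a b; rewrite !coefD; have [Pab|/PK //] := eqVneq P`_a`_b 0.
  by rewrite Pab add0r => /QK.
rewrite -big_split; apply: eq_bigr => a _ /=.
by rewrite -big_split; apply: eq_bigr => b _ /=; rewrite !coefD mulrDl.
Qed.

Lemma extract0 (R : nzRingType) (h : int -> R) (r : int) : extract h r 0 = 0.
Proof. by rewrite /extract size_poly0 big_ord0. Qed.

Lemma extract_sum (R : nzRingType) (h : int -> R) (r : int) (I : Type) (s : seq I)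
    (F : I -> {poly {poly R}}) :
  extract h r (\sum_(i <- s) F i) = \sum_(i <- s) extract h r (F i).
Proof. exact: (big_morph _ (extractD h r) (extract0 h r)). Qed.

Lemma extract_polyC2M (R : nzRingType) (h : int -> R) (r : int) (x : R)
    (Q : {poly {poly R}}) :
  extract h r (polyC2 x * Q) = x * extract h r Q.
Proof.
have [K QK] := bidegree_lt_exists Q; rewrite !(@extractE _ h r K) //; last first.
  by move=> a b; rewrite !coefCM => nz; apply: QK; apply: contraNneq nz => ->; rewrite mulr0.
rewrite mulr_sumr; apply: eq_bigr => a _; rewrite mulr_sumr; apply: eq_bigr => b _.
by rewrite !coefCM mulrA.
Qed.

Lemma extract_polyC2 (R : nzRingType) (h : int -> R) (r : int) (x : R) :
  extract h r (polyC2 x) = x * h r.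
Proof.
rewrite (@extractE _ h r 1) ?big_ord1 ?subr0 ?addr0 ?coefC //= => a b.
by rewrite !coefC; case: a => [|a]; case: b => [|b]; rewrite ?coefC ?eqxx.
Qed.

Lemma extractX (R : nzRingType) (h : int -> R) (r : int) (Q : {poly {poly R}}) :
  extract h r ('X * Q) = extract h (r - 1) Q.
Proof.
have [K QK] := bidegree_lt_exists Q.
rewrite (extractE h (r - 1) QK) (@extractE _ h r K.+1).
  rewrite big_ord_recl big1 ?add0r => [|b _]; last by rewrite coefXM /= coef0 mul0r.
  apply: eq_bigr => a _; rewrite big_ord_recr /= coefXM /=.
  rewrite (contraNeq (@QK a K)) ?ltnn ?andbF // mul0r addr0.
  by apply: eq_bigr => b _; congr (_ * h _); rewrite /bump /=; lia.
move=> [|a] b; rewrite coefXM /= ?coef0 ?eqxx // => /QK /andP[aK bK].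
by rewrite ltnS aK ltnW.
Qed.

(** Here ['X%:P] is w = z^-1, so the index goes up. *)
Lemma extractXC (R : nzRingType) (h : int -> R) (r : int) (Q : {poly {poly R}}) :
  extract h r ('X%:P * Q) = extract h (r + 1) Q.
Proof.
have [K QK] := bidegree_lt_exists Q.
rewrite (extractE h (r + 1) QK) (@extractE _ h r K.+1).
  rewrite big_ord_recr /= [X in _ + X]big1 ?addr0 => [|b _]; last first.
    rewrite coefCM coefXM; case: b => [[|b] /= _]; rewrite ?mul0r //.
    by rewrite (contraNeq (@QK K b)) ?ltnn // mul0r.
  apply: eq_bigr => a _; rewrite big_ord_recl coefCM coefXM /= mul0r add0r.
  by apply: eq_bigr => b _; rewrite coefXM; congr (_ * h _); rewrite /bump /=; lia.
move=> a [|b]; rewrite coefCM coefXM /= ?eqxx // => /QK /andP[aK bK].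
by rewrite !ltnS bK (ltnW aK).
Qed.

Lemma extractXn (R : nzRingType) (h : int -> R) (s : nat) (r : int) (Q : {poly {poly R}}) :
  extract h r ('X ^+ s * Q) = extract h (r - s%:Z) Q.
Proof.
elim: s r => [|s IH] r; first by rewrite mul1r subr0.
by rewrite exprS -mulrA extractX IH; congr (extract h _ Q); lia.
Qed.

Lemma extractXCn (R : nzRingType) (h : int -> R) (s : nat) (r : int) (Q : {poly {poly R}}) :
  extract h r ('X%:P ^+ s * Q) = extract h (r + s%:Z) Q.
Proof.
elim: s r => [|s IH] r; first by rewrite mul1r addr0.
by rewrite exprS -mulrA extractXC IH; congr (extract h _ Q); lia.
Qed.

(** * Raising and lowering operators *)

(* [(true, ij)] stands for the operator L_ij and [(false, ij)] for R_ij. *)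
Definition operator : Type := (bool * (nat * nat))%type.

Definition act (x : operator) (s : nat) : idxseq -> idxseq :=
  iter s ((if x.1 then Lop else Rop) x.2).

(** Each operator is a translation of the index sequence, so commutation reduces to linear
    arithmetic. *)
Lemma actE (x : operator) (s : nat) (al : idxseq) (k : nat) :
  act x s al k = al k + (if x.1 then - (k == x.2.1)%:Z else (k == x.2.1)%:Z) * s%:Z
    - (k == x.2.2)%:Z * s%:Z.
Proof.
rewrite /act; elim: s => [|s IH] /=; first by rewrite !mulr0 subr0 addr0.
by case: x.1 IH => IH; rewrite /Lop /Rop IH; lia.
Qed.

Lemma actC (x y : operator) (s s' : nat) (al : idxseq) :
  act x s (act y s' al) = act y s' (act x s al).
Proof. by apply/funext => k; rewrite !actE; lia. Qed.

(** The product of the operators A(x), for [x] in [xs] and with A(u) = (1 - u) / (1 - t u) cut off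
    at exponent [M], applied to the index sequence before [phi] is evaluated. *)
Fixpoint nested (A : nzRingType) (c : Qt -> A) (M : nat) (xs : seq operator)
    (phi : idxseq -> A) (al : idxseq) : A :=
  if xs is x :: xs' then
    \sum_(s < M) c (expcoef s) * nested c M xs' phi (act x s al)
  else phi al.

Lemma nested_cat (A : nzRingType) (c : Qt -> A) (M : nat) (xs ys : seq operator)
    (phi : idxseq -> A) (al : idxseq) :
  nested c M (xs ++ ys) phi al = nested c M xs (nested c M ys phi) al.
Proof.
elim: xs al => //= x xs IH al.
by apply: eq_bigr => s _; rewrite IH.
Qed.

Lemma eq_nested (A : nzRingType) (c : Qt -> A) (M : nat) (xs : seq operator)
    (phi psi : idxseq -> A) (al : idxseq) :
  phi =1 psi -> nested c M xs phi al = nested c M xs psi al.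
Proof.
move=> e; elim: xs al => //= x xs IH al.
by apply: eq_bigr => s _; rewrite IH.
Qed.

Definition icons (r : int) (al : idxseq) : idxseq := fun k => if k is k'.+1 then al k' else r.

Definition oshift (x : operator) : operator := (x.1, (x.2.1.+1, x.2.2.+1)).

Lemma nested_oshift (A : nzRingType) (c : Qt -> A) (M : nat) (xs : seq operator)
    (phi : idxseq -> A) (r : int) (al : idxseq) :
  nested c M (map oshift xs) phi (icons r al)
  = nested c M xs (fun be => phi (icons r be)) al.
Proof.
elim: xs al => //= x xs IH al; apply: eq_bigr => s _; rewrite -IH.
congr (_ * nested _ _ _ _ _); apply/funext => -[|k]; rewrite !actE //=.
  by case: x.1; lia.
by rewrite actE.
Qed.

Lemma extract_nested (R : nzRingType) (c : Qt -> R) (h : int -> R) (r : int) (M : nat)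
    (xs : seq operator) (phi : idxseq -> {poly {poly R}}) (al : idxseq) :
  extract h r (nested (@polyC2 R \o c) M xs phi al)
  = nested c M xs (fun be => extract h r (phi be)) al.
Proof.
elim: xs al => //= x xs IH al; rewrite extract_sum.
by apply: eq_bigr => s _; rewrite extract_polyC2M IH.
Qed.

(** The operators that pair a newly prepended entry with the old positions in [J]. L comes before R,
    as powers of z come before powers of w in [hpleth]. *)
Definition rows (J : seq nat) : seq operator :=
  flatten [seq [:: (true, (0%N, j.+1)); (false, (0%N, j.+1))] | j <- J].

Definition hprod (R : comNzRingType) (h : int -> R) (l : nat) (al : idxseq) : R :=
  \prod_(k < l) h (al k).

Lemma act_rows (s s' j : nat) (r : int) (be : idxseq) :
  act (false, (0%N, j.+1)) s' (act (true, (0%N, j.+1)) s (icons r be))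
  = icons (r - s%:Z + s'%:Z)
      (fun k => if k == j then be k - s%:Z - s'%:Z else be k).
Proof.
apply/funext => -[|k]; rewrite !actE /= ?eqSS.
  by lia.
by case: eqP => _ /=; lia.
Qed.

(** The factors in [J] are expanded one at a time. In the factor of position [j], z^s lowers both
    [r] and the entry by [s], which is L, while w^s' raises [r] and lowers the entry by [s'], which
    is R. *)
Lemma extract_hpleth_in (R : comNzRingType) (c : Qt -> R) (h : int -> R) (M l : nat)
    (J : seq nat) (r : int) (be : idxseq) :
  uniq J -> all (fun j => j < l)%N J ->
  extract h r (\prod_(k < l)
    (if (k : nat) \in J then hpleth c M h (be k) else polyC2 (h (be k))))
  = nested c M (rows J) (hprod h l.+1) (icons r be).
Proof.
elim: J r be => [|j J IH] r be /=.
  move=> _ _; rewrite -rmorph_prod extract_polyC2 /hprod big_ord_recl mulrC /=.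
  by [].
case/andP=> jJ uJ /andP[jl Jl].
rewrite (bigD1 (Ordinal jl)) //= mem_head /hpleth mulr_suml extract_sum.
apply: eq_bigr => s _; rewrite -mulrA extract_polyC2M -mulrA extractXn.
congr (_ * _); rewrite mulr_suml extract_sum; apply: eq_bigr => s' _.
rewrite -mulrA extract_polyC2M -mulrA extractXCn; congr (_ * _).
rewrite act_rows -IH // [in RHS](bigD1 (Ordinal jl)) //= (negbTE jJ) eqxx.
congr (extract h _ (_ * _)); apply: eq_bigr => k kj.
have kj' : (k : nat) != j by apply: contraNneq kj => kj; apply/eqP/val_inj.
by rewrite in_cons (negbTE kj').
Qed.

Lemma extract_hpleth (R : comNzRingType) (c : Qt -> R) (h : int -> R) (M l : nat)
    (r : int) (be : idxseq) :
  extract h r (\prod_(k < l) hpleth c M h (be k))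
  = nested c M (rows (iota 0 l)) (hprod h l.+1) (icons r be).
Proof.
rewrite -extract_hpleth_in ?iota_uniq //; last first.
  by apply/allP => j; rewrite mem_iota.
by congr (extract h r _); apply: eq_bigr => k _; rewrite mem_iota ltn_ord.
Qed.

(** The recursion follows that of [BC]: old pairs move up by one position and the new first entry
    brings its own pairs. *)
Fixpoint operators (l : nat) : seq operator :=
  if l is l'.+1 then map oshift (operators l') ++ rows (iota 0 l') else [::].

Lemma mem_rows (J : seq nat) (x : operator) :
  (x \in rows J) = (x.2.1 == 0%N) && (0 < x.2.2)%N && (x.2.2.-1 \in J).
Proof.
apply/idP/idP.
  case/flatten_mapP=> j jJ; rewrite !inE => /orP[] /eqP -> //=.
case: x => b [[|i] [|j]] //= jJ; apply/flatten_mapP; exists j => //.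
by case: b; rewrite !inE eqxx ?orbT.
Qed.

Lemma mem_operators (l : nat) (x : operator) :
  (x \in operators l) = (x.2.1 < x.2.2 < l)%N.
Proof.
elim: l x => [|l IH] x; first by rewrite ltn0 andbF.
rewrite /= mem_cat mem_rows mem_iota; case: x => b [[|i] [|j]] //=.
- by apply/negbTE; apply/negP; rewrite orbF => /mapP[[b' [i' j']] _ []].
- rewrite add0n; have -> // : (b, (0%N, j.+1)) \in map oshift (operators l) = false.
  by apply/negP => /mapP[[b' [i' j']] _ []].
- by rewrite orbF; apply/negbTE; apply/negP => /mapP[[b' [i' j']] _ []].
rewrite orbF !ltnS -(IH (b, (i, j))); apply/mapP/idP => [[[b' [i' j']] ? [-> -> ->]] //|xl].
by exists (b, (i, j)).
Qed.

Lemma uniq_operators (l : nat) : uniq (operators l).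
Proof.
elim: l => //= l IH; rewrite cat_uniq map_inj_uniq ?IH /=; last first.
  by move=> [b [i j]] [b' [i' j']] [-> -> ->].
apply/andP; split.
  apply/hasPn => x; rewrite mem_rows => /andP[/andP[/eqP x0 _] _].
  by apply/negP => /mapP[y _ yx]; rewrite yx in x0.
rewrite /rows; elim: (iota 0 l) (iota_uniq 0 l) => //= j J IHJ /andP[jJ uJ].
rewrite IHJ // !inE /= andbT -!/(rows J) !mem_rows /=.
by rewrite (negbTE jJ).
Qed.

(** * Creation operators as nested sums *)

(** The invariant [inv] confines the argument to index sequences for which the cutoff [M] gives the
    exact plethysm. *)
Lemma pleth_rel_nested (M : nat) (xs : seq operator) (inv : idxseq -> Prop)
    (phi : forall n, idxseq -> {mpoly Qt[n]})
    (psi : forall n, idxseq -> {poly {poly {mpoly Qt[n]}}}) (al : idxseq) :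
  (forall x s be, x \in xs -> inv be -> inv (act x s be)) ->
  (forall be, inv be -> pleth_rel (phi ^~ be) (psi ^~ be)) -> inv al ->
  pleth_rel (fun n => nested (@mpolyC n Qt) M xs (phi n) al)
            (fun n => nested (@polyC2 _ \o @mpolyC n Qt) M xs (psi n) al).
Proof.
move=> invS rel; elim: xs al invS => [|x xs IH] al invS al_inv /=; first exact: rel.
elim: (index_enum _) => [|s r IHr].
  apply: (eq_pleth_rel _ _ (pleth_rel_const 0)) => n; first by rewrite big_nil mpolyC0.
  by rewrite big_nil rmorph0.
apply: eq_pleth_rel (pleth_relD (pleth_relM (pleth_rel_const (expcoef s))
  (IH (act x s al) _ _)) IHr) => [n|n||]; rewrite ?big_cons //.
- by move=> y s' be yxs; apply: invS; rewrite inE yxs orbT.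
- by apply: invS; rewrite ?mem_head.
Qed.

(** A negative entry makes both products vanish; otherwise the bound on the sum bounds each entry,
    so that [pleth_rel_hsym] applies. *)
Lemma pleth_rel_hprod (M l : nat) (be : idxseq) :
  \sum_(k < l) be k < M%:Z ->
  pleth_rel (fun n => hprod (hsym Qt ^~ n) l be)
    (fun n => \prod_(k < l) hpleth (@mpolyC n Qt) M (hsym Qt ^~ n) (be k)).
Proof.
move=> beM; have [neg|pos] := boolP [exists k : 'I_l, be k < 0].
  have /existsP[k bek] := neg.
  apply: (eq_pleth_rel _ _ (pleth_rel_const 0)) => n.
    rewrite mpolyC0 /hprod (bigD1 k) //=; case: (be k) bek => // d _.
    by rewrite mul0r.
  rewrite (bigD1 k) //= hpleth_neg ?mul0r ?rmorph0 //.
  by case.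
have be0 k : 0 <= be (k : 'I_l).
  by rewrite Order.TotalTheory.leNgt; apply: contra pos => ?; apply/existsP; exists k.
have beM' k : be (k : 'I_l) < M%:Z.
  apply: Order.POrderTheory.le_lt_trans beM; rewrite (bigD1 k) //=.
  by rewrite Num.Theory.lerDl Num.Theory.sumr_ge0.
rewrite /hprod; elim: (index_enum _) => [|k s IH].
  apply: (eq_pleth_rel _ _ (pleth_rel_const 1)) => n.
    by rewrite big_nil mpolyC1.
  by rewrite big_nil rmorph1.
have := be0 k; have := beM' k; case bek : (be k) => [d|//] dM _.
apply: eq_pleth_rel (pleth_relM (pleth_rel_hsym (dM : (d < M)%N)) IH) => n.
  by rewrite big_cons bek.
by rewrite big_cons bek.
Qed.

Lemma BC_nested (la : seq nat) (M n : nat) :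
  (sumn la < M)%N ->
  BC la n = nested (@mpolyC n Qt) M (operators (size la))
    (hprod (hsym Qt ^~ n) (size la)) (seq_idx la).
Proof.
elim: la n => [|r la IH] n laM; first by rewrite /= /hprod big_ord0.
set l := size la.
have {}laM : (sumn la < M)%N by apply: leq_ltn_trans laM; rewrite /= leq_addl.
rewrite -[LHS]/(extract (hsym Qt ^~ n) r%:Z (pleth (BC la) n)).
have rel : pleth_rel (BC la) (fun n => nested (@polyC2 _ \o @mpolyC n Qt) M (operators l)
    (fun be => \prod_(k < l) hpleth (@mpolyC n Qt) M (hsym Qt ^~ n) (be k)) (seq_idx la)).
  apply: (@eq_pleth_rel (fun n => nested (@mpolyC n Qt) M (operators l)
    (hprod (hsym Qt ^~ n) l) (seq_idx la))) => [m|m|] //; first by rewrite IH.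
  (* The sum of the entries is preserved by R and lowered by L, so its bound is an invariant. *)
  apply: (@pleth_rel_nested M (operators l) (fun be => \sum_(k < l) be k < M%:Z)
    (fun n => hprod (hsym Qt ^~ n) l)
    (fun n be => \prod_(k < l) hpleth (@mpolyC n Qt) M (hsym Qt ^~ n) (be k))).
  - move=> x s be; rewrite mem_operators => /andP[x12 x2].
    apply: Order.POrderTheory.le_lt_trans.
    under eq_bigr do rewrite actE.
    have sum_delta (i : nat) : (i < l)%N ->
        \sum_(k < l) ((k : nat) == i)%:Z * s%:Z = s%:Z.
      move=> il; rewrite (bigD1 (Ordinal il)) //= eqxx mul1r big1 ?addr0 // => k ki.
      rewrite (_ : (k : nat) == i = false) ?mul0r //.
      by apply: contraNF ki => /eqP ki; apply/eqP/val_inj.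
    rewrite !big_split /= sumrN sum_delta //; case: x.1.
      under [X in _ + X - _]eq_bigr do rewrite mulNr.
      by rewrite sumrN sum_delta ?(ltn_trans x12) // -addrA Num.Theory.gerDl; lia.
    by rewrite sum_delta ?(ltn_trans x12) // addrK.
  - exact: pleth_rel_hprod.
  have -> : \sum_(k < l) seq_idx la k = (sumn la)%:Z.
    by rewrite sumnE (big_nth 0%N) big_mkord rmorph_sum.
  by [].
rewrite (pleth_relE n rel) extract_nested.
(* Extraction supplies the operators on the pairs with the new entry; the earlier ones act on the
   shifted positions. *)
under eq_nested do rewrite extract_hpleth.
rewrite -nested_oshift -nested_cat; congr nested.
by apply/funext => -[].
Qed.

(** * Families of exponents *)

Lemma nested_act (A : nzRingType) (c : Qt -> A) (M : nat) (xs : seq operator)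
    (phi : idxseq -> A) (y : operator) (s : nat) (al : idxseq) :
  nested c M xs phi (act y s al) = nested c M xs (phi \o act y s) al.
Proof.
elim: xs al => //= x xs IH al.
by apply: eq_bigr => s' _; rewrite actC IH.
Qed.

Lemma nested_sum (A : comNzRingType) (c : Qt -> A) (M : nat) (xs : seq operator)
    (I : Type) (r : seq I) (a : I -> A) (phi : I -> idxseq -> A) (al : idxseq) :
  nested c M xs (fun be => \sum_(i <- r) a i * phi i be) al
  = \sum_(i <- r) a i * nested c M xs (phi i) al.
Proof.
elim: xs al => //= x xs IH al.
under eq_bigr do rewrite IH mulr_sumr.
rewrite exchange_big; apply: eq_bigr => i _ /=; rewrite mulr_sumr.
by apply: eq_bigr => s _; rewrite mulrCA.
Qed.

Lemma nestedC (A : comNzRingType) (c : Qt -> A) (M : nat) (xs ys : seq operator)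
    (phi : idxseq -> A) (al : idxseq) :
  nested c M xs (nested c M ys phi) al = nested c M ys (nested c M xs phi) al.
Proof.
elim: xs al => //= x xs IH al; rewrite nested_sum; apply: eq_bigr => s _.
by rewrite IH nested_act.
Qed.

Lemma nested_perm (A : comNzRingType) (c : Qt -> A) (M : nat) (xs ys : seq operator)
    (phi : idxseq -> A) (al : idxseq) :
  perm_eq xs ys -> nested c M xs phi al = nested c M ys phi al.
Proof.
pose P zs := forall be, nested c M zs phi be = nested c M ys phi be.
rewrite perm_sym => ysxs; suff: P xs by apply.
apply: (@catCA_perm_ind _ P _ ys xs ysxs) => // s1 s2 s3 E be.
by rewrite -E !catA !nested_cat nestedC.
Qed.

Definition dec_op (b : bool) : nat * nat -> idxseq -> idxseq := if b then Lop else Rop.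

Definition shift_at (b : bool) (ij : nat * nat) (k : nat) : int :=
  (if b then - (k == ij.1)%:Z else (k == ij.1)%:Z) - (k == ij.2)%:Z.

Lemma opmonomialE (b : bool) (a : exponents) (al : idxseq) (k : nat) :
  opmonomial (dec_op b) a al k
  = al k + \sum_(ij <- finsupp a) shift_at b ij k * (a ij)%:Z.
Proof.
rewrite /opmonomial; elim: (enum_fset (finsupp a)) => [|ij s IH].
  by rewrite !big_nil addr0.
rewrite !big_cons /= -[iter _ _ _]/(act (b, ij) (a ij) _) actE IH /shift_at /=.
by case: b {IH}; ring.
Qed.

(** Whether [p] enters the support depends on [s] being nonzero; the condition on [G p 0] makes the
    two cases agree. *)
Lemma big_finsupp_with (R : Type) (idx : R) (op : Monoid.com_law idx) (a : exponents)
    (p : nat * nat) (s : nat) (G : nat * nat -> nat -> R) :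
  p \notin finsupp a -> G p 0%N = idx ->
  \big[op/idx]_(ij <- finsupp [fsfun a with p |-> s]) G ij ([fsfun a with p |-> s] ij)
  = op (G p s) (\big[op/idx]_(ij <- finsupp a) G ij (a ij)).
Proof.
move=> pa G0; have e : \big[op/idx]_(ij <- finsupp a) G ij ([fsfun a with p |-> s] ij)
    = \big[op/idx]_(ij <- finsupp a) G ij (a ij).
  rewrite [LHS]big_seq [RHS]big_seq; apply: eq_bigr => ij ija.
  by rewrite fsfun_withE; case: eqP => // eij; rewrite -eij ija in pa.
rewrite finsupp_with; case: eqP => [->|_].
  rewrite mem_fsetD1 // G0 Monoid.mul1m.
  rewrite [LHS]big_seq [RHS]big_seq; apply: eq_bigr => ij ija.
  by rewrite fsfun_withE; case: eqP => // eij; rewrite -eij ija in pa.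
by rewrite big_fsetU1 //= e fsfun_with.
Qed.

Fixpoint exps (M : nat) (ps : seq (nat * nat)) : seq exponents :=
  if ps is p :: ps' then
    [seq [fsfun a with p |-> s] | s <- iota 0 M, a <- exps M ps']
  else [:: [fsfun]].

Lemma exps_supp (M : nat) (ps : seq (nat * nat)) (a : exponents) :
  a \in exps M ps -> {subset finsupp a <= ps}.
Proof.
elim: ps a => [|p ps IH] a /=.
  by rewrite inE => /eqP -> ij; rewrite finsupp0.
case/allpairsP=> -[s a'] /= [_ /IH a'ps ->] ij.
rewrite finsupp_with inE; case: eqP => _; rewrite !inE.
  by case/andP=> _ /a'ps ->; rewrite orbT.
by case/orP=> [->//|/a'ps ->]; rewrite orbT.
Qed.

Lemma mem_exps (M : nat) (ps : seq (nat * nat)) (a : exponents) :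
  {subset finsupp a <= ps} -> (forall p, (a p < M)%N) -> uniq ps ->
  a \in exps M ps.
Proof.
elim: ps a => [|p ps IH] a /= aps aM.
  move=> _; rewrite inE; apply/eqP/fsfunP => ij; rewrite fsfun0E.
  by apply: fsfun_dflt; apply/negP => /aps.
case/andP=> pps ups; apply/allpairsP; exists (a p, [fsfun a with p |-> 0%N]) => /=.
split; first by rewrite mem_iota aM.
  apply: IH => // [ij|q]; last first.
    by rewrite fsfun_withE; case: eqP => // _; apply: leq_ltn_trans (aM p).
  rewrite finsupp_with eqxx !inE => /andP[ijp /aps].
  by rewrite inE (negbTE ijp).
by apply/fsfunP => q; rewrite !fsfun_withE; case: eqP => [->|].
Qed.

Lemma uniq_exps (M : nat) (ps : seq (nat * nat)) : uniq ps -> uniq (exps M ps).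
Proof.
elim: ps => //= p ps IH /andP[pps ups]; apply: allpairs_uniq => //.
- exact: iota_uniq.
- exact: IH.
(* Overwriting the value at [p] loses no information, since it was 0 before. *)
have off a : a \in exps M ps -> a p = 0%N.
  by move/exps_supp => aps; apply: fsfun_dflt; apply: contra pps; apply: aps.
move=> _ _ /allpairsP[[s a] /= [_ aE ->]] /allpairsP[[s' a'] /= [_ aE' ->]] /= e.
have := congr1 (fun f : exponents => f p) e; rewrite /= !fsfun_with => <-.
congr (_, _); apply/fsfunP => q; have [->|qp] := eqVneq q p; first by rewrite !off.
have := congr1 (fun f : exponents => f q) e.
by rewrite /= !fsfun_withE (negbTE qp).
Qed.

Definition expweight (A : nzRingType) (c : Qt -> A) (a : exponents) : A :=
  \prod_(ij <- finsupp a) c (expcoef (a ij)).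

(** Distributivity: choosing one exponent in each factor amounts to choosing a family of
    exponents. *)
Lemma nested_exps (A : comNzRingType) (c : {rmorphism Qt -> A}) (M : nat) (b : bool)
    (ps : seq (nat * nat)) (phi : idxseq -> A) (al : idxseq) : uniq ps ->
  nested c M [seq (b, p) | p <- ps] phi al
  = \sum_(a <- exps M ps) expweight c a * phi (opmonomial (dec_op b) a al).
Proof.
elim: ps al => [|p ps IH] al /=.
  move=> _; rewrite big_seq1 /expweight finsupp0 big_seq_fset0 mul1r; congr phi.
  by apply/funext => k; rewrite opmonomialE finsupp0 big_seq_fset0 addr0.
case/andP=> pps ups; rewrite big_allpairs_dep -[in iota 0 M](subn0 M) -/(index_iota 0 M) big_mkord.
apply: eq_bigr => s _; rewrite IH // mulr_sumr.
rewrite [LHS]big_seq [RHS]big_seq; apply: eq_bigr => a aE.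
have pa : p \notin finsupp a by apply: contra pps; apply: (exps_supp aE).
rewrite mulrA; congr (_ * phi _).
  by rewrite /expweight (@big_finsupp_with _ _ _ _ _ _ (fun _ s => c (expcoef s))) ?rmorph1.
apply/funext => k; rewrite !opmonomialE actE.
rewrite (@big_finsupp_with _ _ _ _ _ _ (fun ij s => shift_at b ij k * s%:Z)) ?mulr0 //=.
by rewrite /shift_at; case: b {IH} => /=; ring.
Qed.

(** * Finiteness of the raising operator expansion *)

Lemma hsym0 (R : nzRingType) (n : nat) : hsym R 0 n = 1.
Proof. by have [] := newton_hsym R n 0. Qed.

Lemma hseqE (R : comNzRingType) (l n : nat) (al : idxseq) :
  (forall k, (l <= k)%N -> al k = 0) ->
  hseq R al n = hprod (hsym R ^~ n) l al.
Proof.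
move=> al0; rewrite /hprod -(big_mkord xpredT (fun k => hsym R (al k) n)).
rewrite /hseq [RHS]fsbig_seq ?iota_uniq //; symmetry; apply: fsbig_widen => // k [_] /= kl.
rewrite al0 ?hsym0 // leqNgt; apply/negP => kl'; apply: kl.
by rewrite mem_index_iota.
Qed.

Lemma shift_at_eq0 (b : bool) (ij : nat * nat) (k : nat) :
  (ij.1 < ij.2)%N -> (ij.2 < k)%N -> shift_at b ij k = 0.
Proof.
move=> lt12 ltk; rewrite /shift_at !gtn_eqF ?(ltn_trans lt12) //.
by case: b.
Qed.

Lemma sum_shift_at (b : bool) (ij : nat * nat) (m K : nat) :
  (ij.1 < ij.2)%N -> (ij.2 < K)%N ->
  \sum_(m <= k < K) shift_at b ij k
  = (if b then - (m <= ij.1)%N%:Z else (m <= ij.1)%N%:Z) - (m <= ij.2)%N%:Z.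
Proof.
have sum_delta (i : nat) : (i < K)%N ->
    \sum_(m <= k < K) (k == i)%:Z = (m <= i)%N%:Z.
  move=> iK; have [mi|im] := leqP m i.
    rewrite (bigD1_seq i) ?iota_uniq ?mem_index_iota ?mi //= eqxx big1 ?addr0 // => k.
    by move=> /negbTE ->.
  rewrite big_nat big1 // => k /andP[mk _].
  by rewrite gtn_eqF // (leq_trans im).
move=> lt12 ltK; rewrite /shift_at sumrB sum_delta //; congr (_ - _).
by case: b; rewrite ?sumrN sum_delta // (ltn_trans lt12).
Qed.

(** No operator increases a tail sum, and each application of the one at [p] takes 1 away from the
    tail that starts at [p.2]: the lowered entry lies in this tail, the entry [p.1] does not. *)
Lemma opmonomial_tail_sum (b : bool) (a : exponents) (al : idxseq) (p : nat * nat)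
    (K : nat) :
  on_pairs a -> (forall ij, ij \in finsupp a -> (ij.2 < K)%N) ->
  \sum_(p.2 <= k < K) opmonomial (dec_op b) a al k + (a p)%:Z
  <= \sum_(p.2 <= k < K) al k.
Proof.
move=> a_pairs aK; under eq_bigr do rewrite opmonomialE.
rewrite big_split exchange_big /= -addrA Num.Theory.gerDl.
under eq_bigr do rewrite -mulr_suml.
have le0 ij : ij \in finsupp a ->
    (\sum_(p.2 <= k < K) shift_at b ij k) * (a ij)%:Z <= 0.
  move=> ija; rewrite sum_shift_at ?aK ?a_pairs //.
  have := a_pairs _ ija; case: (b); nia.
have [pa|pa] := boolP (p \in finsupp a); last first.
  rewrite [a p]fsfun_dflt // addr0 big_seq; exact: Num.Theory.sumr_le0.
rewrite (big_fsetD1 p) //=.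
have le0' : \sum_(i <- (finsupp a `\ p)%fset)
    (\sum_(p.2 <= k < K) shift_at b i k) * (a i)%:Z <= 0.
  rewrite big_seq; apply: Num.Theory.sumr_le0 => ij; rewrite inE => /andP[_].
  exact: le0.
have lep : (\sum_(p.2 <= k < K) shift_at b p k) * (a p)%:Z + (a p)%:Z <= 0.
  rewrite sum_shift_at ?aK ?a_pairs // leqnn.
  by have := a_pairs _ pa; case: (b); nia.
by move: le0' lep; set X := \sum_(i <- _) _; set Y := (_ * _); lia.
Qed.

Definition pairs (l : nat) : seq (nat * nat) :=
  [seq ij <- [seq (i, j) | i <- iota 0 l, j <- iota 0 l] | (ij.1 < ij.2)%N].

Lemma mem_pairs (l : nat) (ij : nat * nat) : (ij \in pairs l) = (ij.1 < ij.2 < l)%N.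
Proof.
case: ij => i j; rewrite mem_filter /=; case: ltnP => //= ij.
apply/allpairsP/idP => [[[i' j'] /= [_ + [_ ->]]]|jl].
  by rewrite mem_iota.
by exists (i, j); rewrite !mem_iota /= (ltn_trans ij jl).
Qed.

Lemma uniq_pairs (l : nat) : uniq (pairs l).
Proof.
apply/filter_uniq/allpairs_uniq; rewrite ?iota_uniq //.
by move=> [i j] [i' j'] _ _.
Qed.

(** The R operators are put first because [iHL] applies them to the index sequence before the L
    operators. *)
Lemma perm_operators (l : nat) :
  perm_eq ([seq (false, p) | p <- pairs l] ++ [seq (true, p) | p <- pairs l])
    (operators l).
Proof.
apply: uniq_perm; last 1 first.
- move=> [b p]; rewrite mem_cat mem_operators /= -mem_pairs.
  apply/orP/idP => [[]/mapP[q ql [_ ->]] //|pl].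
  by case: b; [right|left]; apply: map_f.
- rewrite cat_uniq !map_inj_uniq ?uniq_pairs /=; try by move=> p q [].
  by rewrite andbT; apply/hasPn => _ /mapP[p _ ->]; apply/negP => /mapP[].
exact: uniq_operators.
Qed.

Lemma sum_nth_le_sumn (s : seq nat) (N : nat) :
  (\sum_(k < N) nth 0 s k <= sumn s)%N.
Proof.
elim: s N => [|x s IH] N; first by rewrite big1 // => k _; rewrite nth_nil.
by case: N => [|N]; rewrite ?big_ord0 // big_ord_recl leq_add2l IH.
Qed.

Lemma seq_idx_tail_sum (la : seq nat) (m K : nat) :
  \sum_(m <= k < K) seq_idx la k <= (sumn (drop m la))%:Z.
Proof.
rewrite -[m in index_iota m]add0n big_addn big_mkord.
rewrite -(rmorph_sum (@Posz)) lez_nat.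
apply: leq_trans (sum_nth_le_sumn _ (K - m)).
by under [leqRHS]eq_bigr do rewrite nth_drop addnC.
Qed.

Lemma opmonomial_support (b : bool) (a : exponents) (al : idxseq) (l : nat) :
  on_pairs a -> (forall ij, ij \in finsupp a -> (ij.2 < l)%N) ->
  (forall k, (l <= k)%N -> al k = 0) ->
  forall k, (l <= k)%N -> opmonomial (dec_op b) a al k = 0.
Proof.
move=> a_pairs al_l al0 k lk; rewrite opmonomialE al0 // add0r big_seq big1 // => ij ija.
by rewrite shift_at_eq0 ?mul0r ?a_pairs // (leq_trans (al_l _ ija)).
Qed.

Lemma exponents_bound (a : exponents) :
  exists K, forall ij, ij \in finsupp a -> (ij.2 < K)%N.
Proof.
exists (\max_(ij <- finsupp a) ij.2.+1)%N => ij ija.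
exact: (@leq_bigmax_seq _ _ xpredT (fun ij : nat * nat => ij.2.+1)).
Qed.

Lemma seq_idx0 (la : seq nat) (k : nat) : (size la <= k)%N -> seq_idx la k = 0.
Proof. by move=> lk; rewrite /seq_idx nth_default. Qed.

(** A nonzero term has no negative entry, hence nonnegative tail sums. The tail from [p.2] has lost
    at least [a p + b p], so this number is at most the corresponding tail sum of [la]: it is 0
    beyond the length and never exceeds [sumn la]. *)
Lemma hseq_neq0_exps (R : comNzRingType) (la : seq nat) (a b : exponents) (n : nat) :
  on_pairs a -> on_pairs b ->
  hseq R (opmonomial Lop a (opmonomial Rop b (seq_idx la))) n != 0 ->
  a \in exps (sumn la).+1 (pairs (size la)) /\ b \in exps (sumn la).+1 (pairs (size la)).
Proof.
move=> a_pairs b_pairs nz.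
have [Ka aK] := exponents_bound a; have [Kb bK] := exponents_bound b.
(* From position [K] on every sequence involved is zero, so tail sums may stop there. *)
pose K := maxn (size la) (maxn Ka Kb).
have {}aK ij : ij \in finsupp a -> (ij.2 < K)%N by move/aK; rewrite /K; lia.
have {}bK ij : ij \in finsupp b -> (ij.2 < K)%N by move/bK; rewrite /K; lia.
set be := opmonomial Rop b (seq_idx la) in nz; set al := opmonomial Lop a be in nz.
have be0 k : (K <= k)%N -> be k = 0.
  apply: (@opmonomial_support false _ _ _ b_pairs bK) => j Kj.
  by rewrite seq_idx0 // (leq_trans _ Kj) // leq_maxl.
have al0 k : (K <= k)%N -> al k = 0 by apply: (@opmonomial_support true _ _ _ a_pairs aK).
have al_ge0 k : 0 <= al k.
  have [Kk|kK] := leqP K k; first by rewrite al0.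
  case alk : (al k) => [//|d]; case/eqP: nz.
  by rewrite (@hseqE _ K n al al0) /hprod (bigD1 (Ordinal kK)) //= alk mul0r.
have bound p : (a p + b p <= sumn (drop p.2 la))%N.
  have := opmonomial_tail_sum true be p a_pairs aK.
  have := opmonomial_tail_sum false (seq_idx la) p b_pairs bK.
  have := seq_idx_tail_sum la p.2 K.
  rewrite -/be -/al; have : 0 <= \sum_(p.2 <= k < K) al k by exact: Num.Theory.sumr_ge0.
  set x1 := \sum_(_ <= k < K) al k; set x2 := \sum_(_ <= k < K) be k.
  by set x3 := \sum_(_ <= k < K) _; lia.
have lt_size p : (a p + b p != 0)%N -> (p.2 < size la)%N.
  apply: contraNT; rewrite -leqNgt => lp.
  by have := bound p; rewrite drop_oversize // leqn0.
have small p : (a p + b p < (sumn la).+1)%N.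
  rewrite ltnS (leq_trans (bound p)) // -[in X in (_ <= X)%N](cat_take_drop p.2 la).
  by rewrite sumn_cat leq_addl.
split; apply: mem_exps; rewrite ?uniq_pairs // => p.
- rewrite mem_pairs => pa; rewrite a_pairs //= lt_size //.
  by move: pa; rewrite mem_finsupp; lia.
- by have := small p; lia.
- rewrite mem_pairs => pb; rewrite b_pairs //= lt_size //.
  by move: pb; rewrite mem_finsupp; lia.
- by have := small p; lia.
Qed.

(** * Specialization at theta = 1 *)

Lemma map_hsym (r : int) (n : nat) :
  map_mpoly (horner_eval (1 : Qt)) (hsym {poly Qt} r n) = hsym Qt r n.
Proof.
case: r => [d|d]; last by rewrite raddf0.
by rewrite /hsym raddf_sum; apply: eq_bigr => m _; exact: map_mpolyX.
Qed.

Lemma opcoef1 (a b : exponents) :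
  (opcoef a b).[1] = expweight idfun a * expweight idfun b.
Proof.
rewrite /opcoef hornerM !horner_prod; congr (_ * _); apply: eq_bigr => ij _.
  by rewrite hornerM hornerXn expr1n mulr1 hornerC.
by rewrite hornerC.
Qed.

Lemma iHL_nested (la : seq nat) (n : nat) :
  at_theta1 (iHL la) n = nested (@mpolyC n Qt) (sumn la).+1 (operators (size la))
    (hprod (hsym Qt ^~ n) (size la)) (seq_idx la).
Proof.
set M := (sumn la).+1; set l := size la; set ps := pairs l.
rewrite -(nested_perm _ _ _ _ (perm_operators l)) nested_cat.
rewrite nested_exps ?uniq_pairs //.
under [RHS]eq_bigr do rewrite nested_exps ?uniq_pairs // mulr_sumr.
rewrite exchange_big /= /at_theta1 /iHL.
set F := fun ab : exponents * exponents => opcoef ab.1 ab.2 *: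
  hseq {poly Qt} ((opmonomial Lop ab.1 \o opmonomial Rop ab.2) (seq_idx la)) n.
have exps_pairs a : a \in exps M ps -> on_pairs a.
  by move=> aE ij /(exps_supp aE); rewrite mem_pairs => /andP[].
have exps_size a : a \in exps M ps -> forall ij, ij \in finsupp a -> (ij.2 < l)%N.
  by move=> aE ij /(exps_supp aE); rewrite mem_pairs => /andP[].
pose r := [seq (a, b) | a <- exps M ps, b <- exps M ps].
(* The sum over all families reduces to the finite list [r], outside of which the terms vanish by
   [hseq_neq0_exps]. *)
rewrite -(@fsbig_widen _ _ _ _ [set` r]%classic _ F); first last.
- move=> [a b] [[/= a_pairs b_pairs] abr]; rewrite /preimage /= /F /=.
  apply: contra_notP abr => /eqP nz; apply/allpairsP; exists (a, b) => /=.
  have := @hseq_neq0_exps {poly Qt} la a b n a_pairs b_pairs.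
  case=> [|aE bE]; last by split.
  by apply: contraNneq nz => /= ->; rewrite scaler0.
- move=> _ /= /allpairsP[[a b] /= [aE bE ->]].
  by split; apply: exps_pairs.
rewrite -fsbig_seq; last by rewrite allpairs_uniq ?uniq_exps ?uniq_pairs // => -[? ?] [? ?].
rewrite big_allpairs raddf_sum /= [LHS]big_seq [RHS]big_seq.
apply: eq_bigr => a aE; rewrite raddf_sum [LHS]big_seq [RHS]big_seq.
apply: eq_bigr => b bE; rewrite /F /= map_mpolyZ.
rewrite (@hseqE _ l) ?rmorph_prod; last first.
  apply: (@opmonomial_support true) => //; [exact: exps_pairs|exact: exps_size|].
  apply: (@opmonomial_support false) => //; [exact: exps_pairs|exact: exps_size|].
  exact: seq_idx0.
rewrite [_ (opcoef a b)]opcoef1 mulrA -mul_mpolyC; congr (_ * _).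
  by rewrite mulrC mpolyCM /expweight !rmorph_prod.
by apply: eq_bigr => k _; exact: map_hsym.
Qed.

Theorem proposition2p17 (la : seq nat) (hla : is_partition la) :
  at_theta1 (iHL la) = BC la.
Proof.
apply: functional_extensionality_dep => n.
(* The cutoff is the one of [iHL_nested], so both sides become the same nested sum. *)
by rewrite iHL_nested (@BC_nested la (sumn la).+1).
Qed.
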